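(* There exist an absolute constant $c>0$ and infinitely many Cayley graphs $\Gamma$ with the following property. Let $n$ be the number of vertices of $\Gamma$. Then the adjacency matrix of $\Gamma$ has an eigenspace $E$ such that every eigenfunction $x \in E$ (viewed as $x\colon G \to \mathbb{C}$, $G$ the underlying group) satisfies \[ \|x\|_{L^\infty(G)} \ge c\,\frac{\sqrt{\log n}}{\log\log n}\,\|x\|_{L^2(G)}. \]
   Context: A Cayley graph on a finite group $G$ with symmetric generating set $S=S^{-1}\subseteq G$ not containing the identity is the unweighted undirected graph with vertex set $G$ and edges $\{g, sg\}$ for $g\in G$, $s\in S$; its adjacency matrix acts on functions $x\colon G\to\mathbb{C}$. Norms are normalized with respect to the uniform probability measure: $\|x\|_{L^p(G)} = (\mathbb{E}_{g\in G}|x(g)|^p)^{1/p}$ and $\|x\|_{L^\infty(G)}=\max_{g}|x(g)|$. *)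

(* Defs.v *)
From HB Require Import structures.
From mathcomp Require Import all_boot all_order all_algebra all_fingroup.
From mathcomp Require Import complex.
From mathcomp Require Import reals exp.

Set Implicit Arguments.
Unset Strict Implicit.
Unset Printing Implicit Defensive.

Import Order.TTheory GRing.Theory Num.Theory.

Local Open Scope ring_scope.

Definition cayley_set (gT : finGroupType) (S : {set gT}) : Prop :=
  [/\ (S^-1 = S)%g, (<<S>> = [set: gT])%g & (1%g \notin S)].

Definition cayley_edge (gT : finGroupType) (S : {set gT}) : rel gT :=
  fun g h => [exists s in S, h == (s * g)%g].

Lemma cayley_edge_sym (gT : finGroupType) (S : {set gT}) :
  cayley_set S -> symmetric (cayley_edge S).
Proof.
case=> SV _ _; have sub g h : cayley_edge S g h -> cayley_edge S h g.
  case/exists_inP=> s sS /eqP->; apply/exists_inP.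
  by exists (s^-1)%g; rewrite ?mulKg // -SV memV_invg.
by move=> g h; apply/idP/idP; apply: sub.
Qed.

Lemma cayley_edge_irrefl (gT : finGroupType) (S : {set gT}) :
  cayley_set S -> irreflexive (cayley_edge S).
Proof.
case=> _ _ S1 g; apply/exists_inP; case=> s sS.
by rewrite -{1}[g]mul1g => /eqP/mulIg s1; rewrite s1 sS in S1.
Qed.

(* Vertices are numbered by the enumeration of gT. *)
Definition cayley_adjmx (C : nzRingType) (gT : finGroupType) (S : {set gT}) :
    'M[C]_#|gT| :=
  \matrix_(i, j) (cayley_edge S (enum_val i) (enum_val j))%:R.

Definition fun_row (C : Type) (gT : finType) (x : gT -> C) : 'rV[C]_#|gT| :=
  \row_j x (enum_val j).

(* The adjacency matrix is symmetric, so the row vectors on which eigenspace is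
   based give the same eigenfunctions as column vectors. *)
Lemma tr_cayley_adjmx (C : nzRingType) (gT : finGroupType) (S : {set gT}) :
  cayley_set S -> (cayley_adjmx C S)^T = cayley_adjmx C S.
Proof. by move=> cS; apply/matrixP=> i j; rewrite !mxE cayley_edge_sym. Qed.

Lemma fun_row_eigenspaceP (C : fieldType) (gT : finGroupType) (S : {set gT})
    (x : gT -> C) (lambda : C) : cayley_set S ->
  reflect (forall g, \sum_(s in S) x (s * g)%g = lambda * x g)
    (fun_row x <= eigenspace (cayley_adjmx C S) lambda)%MS.
Proof.
move=> cS; have act i : (fun_row x *m cayley_adjmx C S) 0 i =
    \sum_(s in S) x (s * enum_val i)%g.
  rewrite mxE (reindex enum_rank) /=; last first.
    by apply: onW_bij; apply: enum_rank_bij.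
  rewrite (reindex_inj (mulIg (enum_val i))) [RHS]big_mkcond /=.
  apply: eq_bigr => s _; rewrite !mxE enum_rankK cayley_edge_sym //.
  have -> : cayley_edge S (enum_val i) (s * enum_val i)%g = (s \in S).
    by apply/exists_inP/idP => [[t tS /eqP/mulIg ->]|sS] //; exists s.
  by case: (s \in S); rewrite ?mulr1 ?mulr0.
apply: (iffP eigenspaceP) => [xA g|xA].
  by have /rowP/(_ (enum_rank g)) := xA; rewrite act !mxE enum_rankK.
by apply/rowP => i; rewrite act xA !mxE.
Qed.

Definition Lpnorm (R : realType) (gT : finType) (p : R) (x : gT -> R[i]) : R :=
  powR (#|gT|%:R^-1 * \sum_g powR (ComplexField.Normc.normc (x g)) p) p^-1.

Definition Linfnorm (R : realType) (gT : finType) (x : gT -> R[i]) : R :=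
  \big[Order.max/0]_g ComplexField.Normc.normc (x g).

(* Main.v *)
Require Import Defs.
From HB Require Import structures.
From mathcomp Require Import all_boot all_order all_algebra all_fingroup.
From mathcomp Require Import finfield.
From mathcomp Require Import complex.
From mathcomp Require Import reals exp.
From mathcomp Require Import ring lra zify.

Import Order.TTheory GRing.Theory Num.Theory.

Local Open Scope ring_scope.

(** Let G be the symmetric group of degree D acting on functions with sum zero,
    and let w be such a function.  On the group algebra, the element
    [\sum_s <s w, w> s] is a multiple of the projection whose image consists of
    the matrix coefficients g |-> <g w, u>, and adding a constant to all
    multiplicities only changes the eigenvalue of the constant functions.
    Nonnegative integer multiplicities mu(s) are realized by an honest
    generating set of G * F^2, for a finite field F: put over s the first mu(s)
    lines through the origin of F^2, minus the origin.  Any nontrivial character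
    of F^2 is trivial on at most one line, so functions that are not constant
    along F^2 only see much smaller eigenvalues.

    By orthogonality, the mean square of <g w, u> is |w|^2 |u|^2 / (D - 1).  If w
    takes the values +-(D / i)^(1/2), rounded, then sorting u gives
    max_g |<g w, u>| >= c sqrt D |u| whereas |w|^2 is of order D log D; since
    log n is of order D log D, this is the claimed bound. *)

(** * Sums along lines in the plane over a finite field *)

Section LineSums.
Variables (R : realFieldType) (F : finFieldType).
Implicit Types (y z : F * F -> R) (e h : F * F).

Definition line_sum e y h : R := \sum_(t : F) y ((t * e.1, t * e.2) + h).

Lemma line_sum_shift e y (t : F) h :
  line_sum e y ((t * e.1, t * e.2) + h) = line_sum e y h.
Proof.
rewrite /line_sum [RHS](reindex_inj (addIr t)) /=; apply: eq_bigr => u _.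
by congr y; rewrite !mulrDl addrA.
Qed.

(** Since [line_sum e z] is constant in direction [e], translating [y] in that direction does not
    change the pairing, and the [#|F|] translates of [y] add up to its line sum. Thus [line_sum e]
    divided by [#|F|] is an orthogonal projection. *)
Lemma line_sum_dot e y z :
  #|F|%:R * \sum_h y h * line_sum e z h =
  \sum_h line_sum e y h * line_sum e z h.
Proof.
under [RHS]eq_bigr => h _ do rewrite {1}/line_sum mulr_suml.
rewrite exchange_big /= mulr_natl -sumr_const; apply: eq_bigr => t _.
rewrite [LHS](reindex_inj (addrI (t * e.1, t * e.2))) /=.
by apply: eq_bigr => h _; rewrite line_sum_shift.
Qed.

(** The lines through [h] cover every other point exactly once and [h] itself once per direction,
    that is [#|F| + 1] times. *)
Lemma sum_line_sum y h :
  \sum_k line_sum (1, k) y h + line_sum (0, 1) y h =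
  #|F|%:R * y h + \sum_h' y h'.
Proof.
rewrite exchange_big /= (bigD1 0) //=.
have -> : \sum_k y ((0 * 1, 0 * k) + h) = #|F|%:R * y h.
  rewrite mulr_natl -sumr_const; apply: eq_bigr => k _.
  by rewrite !mul0r add0r.
rewrite -addrA; congr (_ + _).
rewrite [RHS](reindex_inj (addIr h)) /=.
(* The column [a = 0] is the vertical line; in a column [t != 0], each point lies on the line of
   exactly one slope. *)
rewrite -(pair_bigA _ (fun a b => y ((a, b) + h))) /= [RHS](bigD1 0) //= addrC.
congr (_ + _); first by apply: eq_bigr => t _; rewrite mulr0 mulr1.
apply: eq_bigr => t t0; rewrite [RHS](reindex_inj (mulfI t0)) /=.
by apply: eq_bigr => k _; rewrite mulr1.
Qed.

(** On functions of sum zero the line projections over all directions add up to the identity, so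
    their squared norms add up to that of [y]; the vertical direction is dropped. *)
Lemma sum_line_sum_sqr_le y : \sum_h y h = 0 ->
  \sum_k \sum_h line_sum (1, k) y h ^+ 2 <= #|F|%:R ^+ 2 * \sum_h y h ^+ 2.
Proof.
move=> y0; pose V := \sum_h line_sum (0, 1) y h ^+ 2.
suff -> : \sum_k \sum_h line_sum (1, k) y h ^+ 2 =
          #|F|%:R ^+ 2 * (\sum_h y h ^+ 2) - V.
  by rewrite gerBl; apply: sumr_ge0 => h _; rewrite sqr_ge0.
have sqE e : \sum_h line_sum e y h ^+ 2 = #|F|%:R * \sum_h y h * line_sum e y h.
  by rewrite line_sum_dot; apply: eq_bigr => h _; rewrite expr2.
rewrite /V sqE (eq_bigr _ (fun k _ => sqE (1, k))) -mulr_sumr expr2 -mulrA.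
rewrite -mulrBr; congr (_ * _); rewrite exchange_big /= mulr_sumr -sumrB.
apply: eq_bigr => h _; rewrite -mulr_sumr.
have /eqP := sum_line_sum y h; rewrite y0 addr0 -subr_eq0 => /eqP E.
have -> : \sum_k line_sum (1, k) y h =
   #|F|%:R * y h - line_sum (0, 1) y h by lra.
ring.
Qed.

(* Cauchy-Schwarz (as 2ab <= a^2 + b^2) over the chosen lines, using that the
   normalized line sums are projections. *)
Lemma sum_lines_dot_le (P : pred F) y z : \sum_h y h = 0 -> \sum_h z h = 0 ->
  \sum_(k | P k) \sum_h y h * line_sum (1, k) z h <=
  #|F|%:R / 2 * (\sum_h y h ^+ 2 + \sum_h z h ^+ 2).
Proof.
move=> y0 z0; have q0 : 0 < #|F|%:R :> R by rewrite ltr0n; apply/card_gt0P; exists 0.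
rewrite -(ler_pM2l q0) mulr_sumr (eq_bigr _ (fun k _ => line_sum_dot (1, k) y z)).
have sqr_half (x : F -> F * F -> R) (Q : pred F) :
  \sum_(k | Q k) \sum_h x k h ^+ 2 <= \sum_k \sum_h x k h ^+ 2.
  rewrite [leRHS](bigID Q) /= lerDl; apply: sumr_ge0 => k _.
  by apply: sumr_ge0 => h _; rewrite sqr_ge0.
apply: (@le_trans _ _ (2^-1 * \sum_(k | P k) \sum_h line_sum (1, k) y h ^+ 2 +
                       2^-1 * \sum_(k | P k) \sum_h line_sum (1, k) z h ^+ 2)).
  rewrite -mulrDr -big_split mulr_sumr; apply: ler_sum => k _ /=.
  rewrite -big_split mulr_sumr; apply: ler_sum => h _ /=.
  by have := sqr_ge0 (line_sum (1, k) y h - line_sum (1, k) z h); lra.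
have := sum_line_sum_sqr_le y y0; have := sum_line_sum_sqr_le z z0.
have := sqr_half (fun k => line_sum (1, k) y) P.
have := sqr_half (fun k => line_sum (1, k) z) P.
move: (\sum_(k | P k) _) (\sum_(k | P k) _) (\sum_k _) (\sum_k _).
move=> a b c d ? ? ? ?; nra.
Qed.

End LineSums.

(** * Multiplicities realized by lines in the fibres *)

Lemma sum_pair (V : nmodType) (I J : finType) (phi : I * J -> V) :
  \sum_p phi p = \sum_i \sum_j phi (i, j).
Proof. by rewrite pair_bigA; apply: eq_bigr => -[]. Qed.

Section LineSet.
Variables (F : finFieldType) (gT : finGroupType) (mu : gT -> nat).

(* The fibre over s is the union of the first [mu s] non-vertical lines through
   the origin of the plane F * F, without the origin. *)
Definition line_set : {set gT * (F * F)} :=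
  [set p | (p.2.1 != 0) && (enum_rank (p.2.2 / p.2.1) < mu p.1)%N].

Lemma card_slopes (n : nat) : (n <= #|F|)%N ->
  #|[pred k : F | (enum_rank k < n)%N]| = n.
Proof.
move=> nF; rewrite -[LHS]sum1_card (reindex (@enum_val F predT)) /=; last first.
  by apply: onW_bij; apply: enum_val_bij.
under eq_bigl => i do rewrite inE enum_valK.
by rewrite -(big_ord_widen _ (fun=> 1%N) nF) sum_nat_const card_ord muln1.
Qed.

(** A point off the vertical axis is determined by its slope [k] and first coordinate [t]. Writing
    [t * 1] matches [line_sum] in direction [(1, k)]. *)
Lemma sum_line_set (V : nmodType) (phi : gT * (F * F) -> V) :
  \sum_(p in line_set) phi p =
  \sum_s \sum_(k : F | (enum_rank k < mu s)%N) \sum_(t | t != 0)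
    phi (s, (t * 1, t * k)).
Proof.
rewrite big_mkcond sum_pair; apply: eq_bigr => s _.
rewrite sum_pair [RHS]exchange_big /= [RHS]big_mkcond /=.
apply: eq_bigr => t _; case: eqVneq => [->|t0] /=.
  by apply: big1 => b _; rewrite inE /= eqxx.
rewrite [RHS]big_mkcond (reindex_inj (mulfI t0)) /=; apply: eq_bigr => k _.
by rewrite inE /= t0 mulr1 mulrAC divff ?mul1r.
Qed.

Hypothesis mu_gt0 : forall s, (0 < mu s)%N.
Hypothesis mu1_gt1 : (1 < mu 1%g)%N.
Hypothesis muV : forall s, mu s^-1%g = mu s.

(** Negation preserves slopes, which with [muV] gives symmetry. The fibre over the identity contains
    two lines, which span the plane; every other fibre is nonempty. *)
Lemma cayley_line_set : cayley_set line_set.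
Proof.
have F_gt1 : (1 < #|F|)%N by apply: finRing_gt1.
pose k0 : F := enum_val (Ordinal (ltnW F_gt1)).
pose k1 : F := enum_val (Ordinal F_gt1).
have k10 : k1 - k0 != 0.
  by rewrite subr_eq0; apply/eqP => /enum_val_inj /(congr1 val).
have lineP s k (t : F) : t != 0 -> (enum_rank k < mu s)%N ->
    (s, (t, t * k)) \in line_set.
  by move=> t0 kmu; rewrite inE /= t0 /= mulrAC divff ?mul1r.
(* The origin, excluded from every fibre, is still generated over the identity, where it is the unit
   of the group. *)
have gen0 s k (t : F) : (s != 1%g -> t != 0) -> (enum_rank k < mu s)%N ->
    (s, (t, t * k)) \in <<line_set>>%g.
  move=> st kmu; have [t0|t0] := eqVneq t 0; last exact/mem_gen/lineP.
  have s1 : s = 1%g by apply/eqP; apply: contraT => /st; rewrite t0 eqxx.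
  by rewrite t0 mul0r s1; apply: group1.
split; last by rewrite inE /= eqxx.
  apply/setP => -[s [a b]]; rewrite !inE /= muV; congr (_ && (_ < _)%N).
    by rewrite oppr_eq0.
  by congr (nat_of_ord (enum_rank _)); apply: divrNN.
have r0 s : (enum_rank k0 < mu s)%N by rewrite enum_valK.
have r1 : (enum_rank k1 < mu 1%g)%N by rewrite enum_valK.
have pairM (s s' : gT) (h h' : F * F) :
  ((s, h) * (s', h'))%g = ((s * s')%g, h + h') by [].
have genH (h : F * F) : (1%g, h) \in <<line_set>>%g.
  (* Here [t] solves [(a, b) = t (1, k1) + (a - t) (1, k0)]. *)
  case: h => a b; pose t := (b - a * k0) / (k1 - k0).
  have -> : (1%g : gT, (a, b)) =
      ((1%g, (t, t * k1)%R) * (1%g, (a - t, (a - t) * k0)%R))%g.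
    rewrite pairM mulg1; congr pair; apply/pair_equal_spec; split.
      by rewrite /= addrC subrK.
    have -> : b = t * (k1 - k0) + a * k0 by rewrite /t divfK // subrK.
    by rewrite /=; ring.
  by rewrite groupM // gen0 // eqxx.
apply/eqP; rewrite eqEsubset subsetT /=; apply/subsetP => -[s h] _.
have -> : (s, h) = ((s, (1 : F, 1 * k0)%R) * (1%g, (h - (1, 1 * k0))%R))%g.
  by rewrite pairM mulg1 addrC subrK.
by rewrite groupM // gen0 // oner_neq0.
Qed.

End LineSet.

Arguments line_set {F gT}.

(** * Separation of fibre-constant eigenfunctions from the others *)

Definition eigenfun {R : pzRingType} {gT : finGroupType} (A : {set gT})
    (lambda : R) (y : gT -> R) : Prop :=
  forall g, \sum_(s in A) y (s * g)%g = lambda * y g.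

Section LineSetSpectrum.
Variables (R : realFieldType) (F : finFieldType) (gT : finGroupType).
Variable mu : gT -> nat.
Hypothesis mu_le : forall s, (mu s <= #|F|)%N.

Local Notation q := (#|F|%:R : R).
Local Notation S := (@line_set F gT mu).

Lemma line_set_act_lift (Y : gT -> R) g h :
  \sum_(s in S) Y (s * (g, h) : gT * (F * F))%g.1 =
  (q - 1) * \sum_s (mu s)%:R * Y (s * g)%g.
Proof.
rewrite sum_line_set mulr_sumr; apply: eq_bigr => s _ /=.
rewrite !sumr_const card_slopes // mulrA -mulrnA -[LHS]mulr_natl natrM.
congr (_ * _ * _).
have /(congr1 (fun n => n%:R : R)) := cardC1 (0 : F).
have -> : #|F|.-1%:R = q - 1 by rewrite -subn1 natrB //; apply/card_gt0P; exists 0.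
by move=> <-; congr (_%:R); apply: eq_card.
Qed.

(** A line without the origin acts as its line sum minus the identity. For fixed [s] the line sums
    cost at most [q / 2] by [sum_lines_dot_le], and the [mu s] identities at most
    [mu s / 2 <= q / 2]. The bound is uniform in [mu]. *)
Lemma line_set_energy_le (y : gT * (F * F) -> R) :
  (forall g, \sum_h y (g, h) = 0) ->
  \sum_p y p * \sum_(s in S) y (s * p)%g <=
  2 * q * #|gT|%:R * \sum_p y p ^+ 2.
Proof.
move=> y0.
have -> : \sum_p y p * \sum_(s in S) y (s * p)%g =
  \sum_s \sum_g \sum_(k : F | (enum_rank k < mu s)%N)
    (\sum_h y (g, h) * line_sum R F (1, k) (fun h => y ((s * g)%g, h)) h -
     \sum_h y (g, h) * y ((s * g)%g, h)).
  rewrite sum_pair [RHS]exchange_big /=.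
  apply: eq_bigr => g _.
  under eq_bigr => h _ do rewrite sum_line_set mulr_sumr.
  rewrite exchange_big /=; apply: eq_bigr => s _.
  under eq_bigr => h _ do rewrite mulr_sumr.
  rewrite exchange_big /=; apply: eq_bigr => k _.
  rewrite -sumrB; apply: eq_bigr => h _; rewrite -mulrBr; congr (_ * _).
  rewrite /line_sum [in RHS](bigD1 0) //= !mul0r add0r addrAC subrr add0r.
  by apply: eq_bigr.
pose n2 g := \sum_h y (g, h) ^+ 2.
have n2E : \sum_p y p ^+ 2 = \sum_g n2 g.
  by rewrite sum_pair.
have n2s s : \sum_g n2 (s * g)%g = \sum_g n2 g.
  by rewrite [RHS](reindex_inj (mulgI s)).
have -> : 2 * q * #|gT|%:R * \sum_p y p ^+ 2 =
    \sum_(s : gT) \sum_g q * (n2 g + n2 (s * g)%g).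
  rewrite [RHS](eq_bigr (fun=> 2 * q * \sum_g n2 g)) => [|s _].
    by rewrite sumr_const -mulr_natl n2E; ring.
  by rewrite -mulr_sumr big_split /= n2s; ring.
apply: ler_sum => s _; apply: ler_sum => g _; rewrite sumrB.
have dot := sum_lines_dot_le R F (fun k => enum_rank k < mu s)%N
  (fun h => y (g, h)) (fun h => y ((s * g)%g, h)) (y0 _) (y0 _).
have cross : - \sum_h y (g, h) * y ((s * g)%g, h) <=
     2^-1 * (n2 g + n2 (s * g)%g).
  rewrite /n2 -big_split mulr_sumr -sumrN; apply: ler_sum => h _ /=.
  by have := sqr_ge0 (y (g, h) + y ((s * g)%g, h)); lra.
have n2_ge0 g' : 0 <= n2 g' by apply: sumr_ge0 => h _; rewrite sqr_ge0.
rewrite [X in _ - X](_ : _ =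
    (mu s)%:R * \sum_h y (g, h) * y ((s * g)%g, h)); last first.
  by rewrite sumr_const card_slopes // mulr_natl.
have cross' := ler_wpM2l (ler0n _ (mu s)) cross.
have muq : (mu s)%:R * (2^-1 * (n2 g + n2 (s * g)%g)) <=
           q * (2^-1 * (n2 g + n2 (s * g)%g)).
  by rewrite ler_wpM2r ?ler_nat // mulr_ge0 ?addr_ge0 // invr_ge0 ler0n.
rewrite -/(n2 g) -/(n2 (s * g)%g) in dot.
rewrite mulrN in cross'; move: dot cross' muq; lra.
Qed.

(** Subtracting the fibre averages [Y] leaves an eigenfunction [z] with zero fibre sums. Its energy
    is [lambda] times its squared norm, which exceeds the bound of [line_set_energy_le] unless [z]
    vanishes. *)
Lemma eigenfun_line_set_lift (lambda : R) (y : gT * (F * F) -> R) :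
  2 * q * #|gT|%:R < lambda -> eigenfun S lambda y ->
  forall g h, y (g, h) = y (g, 0).
Proof.
move=> lamP eig.
have q0 : q != 0 by rewrite pnatr_eq0 -lt0n; apply/card_gt0P; exists 0.
pose Y g := (q ^+ 2)^-1 * \sum_h y (g, h).
pose z p := y p - Y p.1.
have YE : eigenfun S lambda (fun p => Y p.1).
  case=> g h; rewrite /= /Y. rewrite -mulr_sumr mulrCA; congr (_ * _).
  rewrite mulr_sumr.
  under eq_bigr => s _ do rewrite (reindex_inj (addrI s.2)) /=.
  rewrite exchange_big /=; apply: eq_bigr => h' _.
  by rewrite -eig; apply: eq_bigr => -[].
have zE : eigenfun S lambda z.
  by move=> p; rewrite /z sumrB YE eig mulrBr.
have z0 g : \sum_h z (g, h) = 0.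
  rewrite sumrB /= sumr_const card_prod /Y -[X in _ - X]mulr_natl natrM -expr2.
  by rewrite mulrA divff ?expf_neq0 // mul1r subrr.
have := line_set_energy_le z z0.
under eq_bigr => p _ do rewrite zE mulrCA -expr2.
rewrite -mulr_sumr -subr_ge0 -mulrBl nmulr_rge0 ?subr_lt0 // => zz.
have zz0 : \sum_p z p ^+ 2 == 0.
  by rewrite eq_le zz; apply: sumr_ge0 => p _; rewrite sqr_ge0.
have {zz zz0} z_0 p : z p = 0.
  move: zz0; rewrite psumr_eq0 => [|i _]; last by rewrite sqr_ge0.
  by move=> /allP /(_ p (mem_index_enum p)); rewrite sqrf_eq0 => /eqP.
move=> g h; have := z_0 (g, h); have := z_0 (g, 0); rewrite /z /=; lra.
Qed.

End LineSetSpectrum.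

(** * Matrix coefficients of the permutation representation *)

Section PermCoefficients.
Variables (R : realFieldType) (T : finType) (w : T -> R).
Hypotheses (cardT : (1 < #|T|)%N) (w_sum : \sum_i w i = 0).
Implicit Types (a b : T -> R) (s g : {perm T}).

Local Notation N := (#|{perm T}|%:R : R).
Local Notation D := (#|T|%:R : R).
Local Notation K := (\sum_i w i ^+ 2).

(** This is the matrix coefficient [<s w, a>], where [s w] takes the value [w i] at [s i]. *)
Definition perm_coef a s : R := \sum_i a (s i) * w i.

Lemma sum_perm_eval a i : D * \sum_(s : {perm T}) a (s i) = N * \sum_j a j.
Proof.
have indep j : \sum_(s : {perm T}) a (s j) = \sum_(s : {perm T}) a (s i).
  rewrite [LHS](reindex_inj (mulgI (tperm i j))) /=.
  by apply: eq_bigr => s _; rewrite permM tpermR.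
rewrite mulr_natl -sumr_const -(eq_bigr _ (fun j _ => indep j)) exchange_big /=.
rewrite mulr_natl -sumr_const; apply: eq_bigr => s _.
by rewrite [RHS](reindex_inj (@perm_inj _ s)).
Qed.

Lemma sum_perm_coef a : \sum_(s : {perm T}) perm_coef a s = 0.
Proof.
have D0 : D != 0 by rewrite pnatr_eq0 -lt0n ltnW.
apply: (mulfI D0); rewrite exchange_big mulr0 mulr_sumr /=.
under eq_bigr => i _ do rewrite -mulr_suml mulrA (sum_perm_eval a i).
by rewrite -mulr_sumr w_sum mulr0.
Qed.

Lemma perm_coef_shift a c s : perm_coef (fun i => a i - c) s = perm_coef a s.
Proof.
rewrite /perm_coef; under eq_bigr => i _ do rewrite mulrBl.
by rewrite sumrB -mulr_sumr w_sum mulr0 subr0.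
Qed.

(** Schur orthogonality, by hand: double transitivity leaves [E i j] only two values, [P] on the
    diagonal and [Q] off it, and [Q] follows from the row sums. Because [w] has sum zero, the
    quadratic form of [E] at [w] is [(P - Q) * K]. *)
Lemma sum_perm_coefM a b :
  \sum_(s : {perm T}) perm_coef a s * perm_coef b s =
  N * K / (D - 1) * (\sum_i a i * b i - (\sum_i a i) * (\sum_i b i) / D).
Proof.
have D0 : D != 0 by rewrite pnatr_eq0 -lt0n ltnW.
have D1 : D - 1 != 0 by rewrite subr_eq0 pnatr_eq1 gtn_eqF.
pose E i j := \sum_(s : {perm T}) a (s i) * b (s j).
pose P := N / D * \sum_i a i * b i.
pose Q := (N / D * ((\sum_i a i) * \sum_i b i) - P) / (D - 1).
have diag i : E i i = P.
  by apply: (mulfI D0); rewrite (sum_perm_eval (fun i => a i * b i)) /P; field.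
have indep i j k : j != i -> k != i -> E i j = E i k.
  move=> ji ki; rewrite /E (reindex_inj (mulgI (tperm j k))) /=.
  by apply: eq_bigr => s _; rewrite !permM tpermL tpermD.
have rowsum i : \sum_j E i j = N / D * ((\sum_i a i) * \sum_i b i).
  rewrite exchange_big /=.
  rewrite (eq_bigr (fun s : {perm T} => a (s i) * \sum_j b j)) => [|s _].
    rewrite -mulr_suml; apply: (mulfI D0); rewrite [LHS]mulrA (sum_perm_eval a i).
    field.
    exact: D0.
  by rewrite -mulr_sumr [in RHS](reindex_inj (@perm_inj _ s)).
have off i j : j != i -> E i j = Q.
  move=> ji; have := rowsum i; rewrite (bigD1 i) //= diag.
  rewrite (eq_bigr (fun=> E i j)) => [|k ki]; last exact: indep.
  rewrite sumr_const.
  have -> : #|[pred k | k != i]| = #|T|.-1.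
    by rewrite -(cardC1 i); apply: eq_card.
  rewrite -[_ *+ _]mulr_natl -subn1 natrB ?(ltnW cardT) // => rE.
  by rewrite /Q -rE addrAC subrr add0r mulrAC divff ?mul1r.
have inner i : \sum_j w j * E i j = w i * (P - Q).
  rewrite (bigD1 i) //= diag (eq_bigr (fun j => w j * Q)) => [|j ji].
    rewrite -mulr_suml; have := w_sum; rewrite (bigD1 i) //= => wE.
    have -> : \sum_(j | j != i) w j = - w i by lra.
    ring.
  by rewrite off.
have -> : \sum_(s : {perm T}) perm_coef a s * perm_coef b s =
    \sum_i w i * \sum_j w j * E i j.
  under [RHS]eq_bigr => i _ do under eq_bigr => j _ do rewrite mulr_sumr.
  under [RHS]eq_bigr => i _ do rewrite exchange_big mulr_sumr.
  rewrite [RHS]exchange_big; apply: eq_bigr => s _ /=.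
  rewrite /perm_coef mulr_suml; apply: eq_bigr => i _.
  rewrite mulr_sumr mulr_sumr; apply: eq_bigr => j _; ring.
under eq_bigr => i _ do rewrite inner mulrA -expr2.
by rewrite -mulr_suml /Q /P; field; rewrite D0 D1.
Qed.

End PermCoefficients.

Arguments perm_coef {R T}.

(** * The Cayley graph attached to an integer weight, and its eigenspace *)

Section PermLineGraph.
Variables (R : realFieldType) (F : finFieldType) (T : finType) (w : T -> int).
Hypotheses (cardT : (1 < #|T|)%N) (w_sum : \sum_i w i = 0).

Local Notation N := (#|{perm T}|%:R : R).
Local Notation D := (#|T|%:R : R).
Local Notation q := (#|F|%:R : R).
Local Notation K := (\sum_i w i ^+ 2).
Local Notation wR := (fun i => (w i)%:~R : R).

(** The shift by [K + 1] makes the integer positive, so [absz] does not alter its value and no fibre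
    is empty. *)
Definition perm_mult (s : {perm T}) : nat :=
  absz (K + 1 + \sum_i w (s i) * w i).

Definition perm_graph : {set {perm T} * (F * F)} := line_set perm_mult.

(** The factor [q - 1] counts the nonzero points of a line; the rest is the constant in
    [sum_perm_coefM]. *)
Definition perm_eigenvalue : R := (q - 1) * (N * K%:~R / (D - 1)).

(** Cauchy-Schwarz in integers: the squared norms of the sum and difference of [w] and its permuted
    copy are nonnegative ([c = 1] and [c = -1]). *)
Lemma perm_mult_bounds s :
  (perm_mult s)%:Z = K + 1 + \sum_i w (s i) * w i /\
  (0 < (perm_mult s)%:Z <= 2 * K + 1)%R.
Proof.
have sK : \sum_i w (s i) ^+ 2 = K by rewrite [RHS](reindex_inj (@perm_inj _ s)).
have sqrE c : \sum_i (w (s i) + c * w i) ^+ 2 =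
    (1 + c ^+ 2) * K + 2 * c * \sum_i w (s i) * w i.
  rewrite (eq_bigr (fun i => w (s i) ^+ 2 + (c ^+ 2 * w i ^+ 2 +
    2 * c * (w (s i) * w i)))) => [|i _]; last by ring.
  by rewrite !big_split /= -!mulr_sumr sK; ring.
have sqr0 c : 0 <= \sum_i (w (s i) + c * w i) ^+ 2.
  by apply: sumr_ge0 => i _; apply: sqr_ge0.
have := sqr0 1; have := sqr0 (-1); rewrite !sqrE /perm_mult.
move: K (\sum_i _) => k f; lia.
Qed.

Lemma perm_multR s :
  (perm_mult s)%:R = K%:~R + 1 + perm_coef wR wR s :> R.
Proof.
rewrite -[LHS]/((perm_mult s)%:Z%:~R) (perm_mult_bounds s).1 !rmorphD /=.
by congr (_ + _); rewrite rmorph_sum; apply: eq_bigr => i _; rewrite rmorphM.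
Qed.

Lemma sum_intr_weight : \sum_i wR i = 0.
Proof. by rewrite -(rmorph_sum (intmul 1)) w_sum. Qed.

Lemma sum_intr_sqr_weight : \sum_i wR i ^+ 2 = K%:~R.
Proof. by rewrite rmorph_sum; apply: eq_bigr => i _; rewrite rmorphXn. Qed.

Hypothesis K_le : 2 * K + 1 <= #|F|%:Z.
Hypothesis K_ge : 2 * (#|F| * #|T|.-1)%:Z < #|F|.-1%:Z * K.

Lemma perm_mult_le s : (perm_mult s <= #|F|)%N.
Proof. by have := perm_mult_bounds s; lia. Qed.

Lemma sum_sqr_weight_gt0 : 0 < K.
Proof.
have K0 : 0 <= K by apply: sumr_ge0 => i _; apply: sqr_ge0.
move: K0 K_ge; move: K => k; nia.
Qed.

Lemma cayley_perm_graph : cayley_set perm_graph.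
Proof.
apply: cayley_line_set => [s||s]; first by have := perm_mult_bounds s; lia.
  rewrite -ltz_nat (perm_mult_bounds 1).1.
  have -> : \sum_i w ((1%g : {perm T}) i) * w i = K.
    by apply: eq_bigr => i _; rewrite perm1.
  by have := sum_sqr_weight_gt0; move: K => k; lia.
apply/eqP; rewrite -eqz_nat; apply/eqP.
rewrite !(perm_mult_bounds _).1; congr (_ + _).
rewrite (reindex_inj (@perm_inj _ s)) /=.
by apply: eq_bigr => i _; rewrite permK mulrC.
Qed.

Lemma field_card_ge1_and_degree_gt1 : 1 <= q /\ 0 < D - 1.
Proof.
rewrite ler1n subr_gt0 ltr1n; split=> //; apply/card_gt0P; exists 0; exact.
Qed.

(** This is [K_ge] with [N / (D - 1)] restored; it meets the threshold of
    [eigenfun_line_set_lift]. *)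
Lemma perm_eigenvalue_gt : 2 * q * N < perm_eigenvalue.
Proof.
have N0 : 0 < N by rewrite ltr0n; apply/card_gt0P; exists 1%g.
have [q1 D1] := field_card_ge1_and_degree_gt1.
have KR : 2 * (q * (D - 1)) < (q - 1) * K%:~R.
  have DE : D - 1 = #|T|.-1%:R by rewrite -subn1 natrB // ltnW.
  have qE : q - 1 = #|F|.-1%:R by rewrite -subn1 natrB // -(ler_nat R).
  by rewrite DE qE -natrM; have := K_ge; rewrite -(ltr_int R) !intrM.
rewrite /perm_eigenvalue.
have -> : (q - 1) * (N * K%:~R / (D - 1)) = N * ((q - 1) * K%:~R) / (D - 1).
  by field; rewrite gt_eqF.
rewrite ltr_pdivlMr //.
by move: KR; rewrite -(ltr_pM2l N0); lra.
Qed.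

(** The right-hand side is the eigenvalue of the constant functions, which must be kept out of the
    eigenspace. *)
Lemma perm_eigenvalue_neq : perm_eigenvalue != (q - 1) * (N * (K%:~R + 1)).
Proof.
have N0 : 0 < N by rewrite ltr0n; apply/card_gt0P; exists 1%g.
have q1 : 0 < q - 1 by rewrite subr_gt0 ltr1n finRing_gt1.
have D1 : 1 <= D - 1 by rewrite lerBrDr -[1 + 1]/(2%:R) ler_nat.
rewrite lt_eqF // /perm_eigenvalue ltr_pM2l // -mulrA ltr_pM2l //.
have KR : 0 < K%:~R :> R by rewrite ltr0z sum_sqr_weight_gt0.
rewrite ltr_pdivrMr ?(lt_le_trans ltr01) //; nra.
Qed.

Lemma perm_graph_act (Y : {perm T} -> R) g h :
  \sum_(s in perm_graph) Y (s * (g, h) : {perm T} * (F * F))%g.1 =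
  (q - 1) * ((K%:~R + 1) * \sum_(s : {perm T}) Y s +
             \sum_(s : {perm T}) perm_coef wR wR s * Y (s * g)%g).
Proof.
rewrite (line_set_act_lift _ _ _ _ perm_mult_le); congr (_ * _).
rewrite [\sum_(s : {perm T}) Y s](reindex_inj (mulIg g)) mulr_sumr -big_split.
by apply: eq_bigr => s _ /=; rewrite perm_multR mulrDl.
Qed.

Lemma eigenfun_perm_graph :
  eigenfun perm_graph perm_eigenvalue (fun p => perm_coef wR wR p.1).
Proof.
case=> g h; rewrite perm_graph_act sum_perm_coef ?sum_intr_weight // mulr0 add0r.
rewrite /perm_eigenvalue -[RHS]mulrA; congr (_ * _).
rewrite (eq_bigr (fun s : {perm T} => perm_coef wR wR s *
    perm_coef wR (fun i => wR (g i)) s)) => [|s _]; last first.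
  by congr (_ * _); apply: eq_bigr => i _; rewrite permM.
rewrite sum_perm_coefM ?sum_intr_weight // mul0r mul0r subr0 sum_intr_sqr_weight.
congr (_ * _).
by apply: eq_bigr => i _; rewrite mulrC.
Qed.

(** The eigenvalue equation itself exhibits [y] as a matrix coefficient: once [y] is constant on
    fibres and has sum zero, the graph acts on it by convolution with [<s w, w>], whose values are
    all coefficients of [w]. *)
Lemma eigenfun_perm_graphP (y : {perm T} * (F * F) -> R) :
  eigenfun perm_graph perm_eigenvalue y ->
  exists v : T -> R, forall g h, y (g, h) = perm_coef wR v g.
Proof.
move=> eig; pose Y g := y (g, 0).
have yY p : y p = Y p.1.
  case: p => g h; exact: (eigenfun_line_set_lift _ _ _ _ perm_mult_le _ _
    perm_eigenvalue_gt eig).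
(* The vector [v] is the combination of the [s w] with coefficients [Y s]. *)
pose v j := \sum_(s : {perm T}) Y s * wR (s^-1%g j).
have lamY g : perm_eigenvalue * Y g =
    (q - 1) * ((K%:~R + 1) * \sum_(s : {perm T}) Y s + perm_coef wR v g).
  rewrite -eig (eq_bigr _ (fun (p : {perm T} * (F * F)) _ => yY (p * (g, 0%R))%g)).
  rewrite perm_graph_act.
  congr (_ * (_ + _)); rewrite (reindex_inj (mulIg g^-1%g)) /=.
  under [RHS]eq_bigr => i _ do rewrite mulr_suml.
  rewrite [RHS]exchange_big; apply: eq_bigr => s _ /=.
  rewrite mulgKV [perm_coef _ _ _](reindex_inj (@perm_inj _ (g * s^-1)%g)) /=.
  rewrite mulr_suml; apply: eq_bigr => i _.
  by rewrite !permM !permKV permK; ring.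
(* Summing [lamY] over [g] makes the total of [Y] scale by the eigenvalue of the constants as
   well. *)
have sumY : \sum_(s : {perm T}) Y s = 0.
  have : perm_eigenvalue * \sum_(s : {perm T}) Y s =
      (q - 1) * (N * (K%:~R + 1)) * \sum_(s : {perm T}) Y s.
    rewrite mulr_sumr (eq_bigr _ (fun g _ => lamY g)) -mulr_sumr big_split /=.
    rewrite sum_perm_coef ?sum_intr_weight // sumr_const addr0 -[_ *+ _]mulr_natl.
    ring.
  move/eqP; rewrite -subr_eq0 -mulrBl mulf_eq0 subr_eq0.
  by rewrite (negPf perm_eigenvalue_neq) => /eqP.
have lam0 : perm_eigenvalue != 0.
  by rewrite gt_eqF // (le_lt_trans _ perm_eigenvalue_gt) // !mulr_ge0 ?ler0n.
exists (fun i => (q - 1) / perm_eigenvalue * v i) => g h.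
rewrite yY /=; apply: (mulfI lam0); rewrite lamY sumY mulr0 add0r.
rewrite /perm_coef !mulr_sumr; apply: eq_bigr => i _; field; exact: lam0.
Qed.

End PermLineGraph.

(** * Large values of matrix coefficients, by sorting *)

Lemma sorting_perm (R : realDomainType) (n : nat) (v : 'I_n -> R) :
  exists p : {perm 'I_n}, forall i j : 'I_n, (i <= j)%N -> v (p j) <= v (p i).
Proof.
pose t := [tuple v i | i < n].
have /tuple_permP[p pE] : perm_eq (sort >=%O t) t by apply/permPl/perm_sort.
have srt : sorted >=%O (sort >=%O t) by apply: sort_sorted => x y; apply: ge_total.
exists p => i j ij; have sz : size (sort >=%O t) = n by rewrite size_sort size_tuple.
have nthE (k : 'I_n) : nth 0 (sort >=%O t) k = v (p k).
  by rewrite pE -(tnth_nth 0 [tuple tnth t (p i) | i < n] k) !tnth_mktuple.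
rewrite -!nthE; apply: (sorted_leq_nth ge_trans (@lexx _ _)) => //;
  by rewrite inE sz.
Qed.

(* With the values of [v] in decreasing order and [c] their median, all terms of
   [perm_coef w v p = \sum_i (v (p i) - c) * w i] are nonnegative, so each
   partial sum bounds the total from below. *)
Lemma perm_coef_large (R : realFieldType) (n : nat) (w : 'I_n -> R) (d : 'I_n)
    (alpha : R) (v : 'I_n -> R) :
  \sum_i w i = 0 ->
  (forall i : 'I_n, (i < d)%N -> 0 <= w i) ->
  (forall i : 'I_n, (d <= i)%N -> w i <= 0) ->
  (forall i : 'I_n, (i < d)%N -> alpha <= w i * \sum_(j : 'I_n | (j <= i)%N) w j) ->
  (forall i : 'I_n, (d <= i)%N -> alpha <= w i * \sum_(j : 'I_n | (i <= j)%N) w j) ->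
  exists (p : {perm 'I_n}) (c : R),
    alpha * \sum_i (v i - c) ^+ 2 <= perm_coef w v p ^+ 2.
Proof.
move=> w0 w_ge0 w_le0 alpha_lo alpha_hi; have [p srt] := sorting_perm _ _ v.
exists p, (v (p d)); pose a i := v (p i) - v (p d).
have a_mono (i j : 'I_n) : (i <= j)%N -> a j <= a i by move=> ij; rewrite lerD2r srt.
have a_ge0 (i : 'I_n) : (i < d)%N -> 0 <= a i by move=> id; rewrite subr_ge0 srt // ltnW.
have a_le0 (i : 'I_n) : (d <= i)%N -> a i <= 0 by move=> id; rewrite subr_le0 srt.
have aw_ge0 i : 0 <= a i * w i.
  have [id|di] := ltnP i d; first by rewrite mulr_ge0 ?a_ge0 ?w_ge0.
  by rewrite mulr_le0 ?a_le0 ?w_le0.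
have TE : perm_coef w v p = \sum_i a i * w i.
  by rewrite -(perm_coef_shift _ _ _ w0 _ (v (p d))).
rewrite (reindex_inj (@perm_inj _ p)) TE -/(\sum_i a i ^+ 2).
have part (P : pred 'I_n) : \sum_(j | P j) a j * w j <= \sum_j a j * w j.
  by rewrite [leRHS](bigID P) /= lerDl sumr_ge0.
have term (i : 'I_n) : alpha * a i ^+ 2 <= (\sum_j a j * w j) * (a i * w i).
  have main (P : pred 'I_n) : alpha <= w i * (\sum_(j | P j) w j) ->
      (forall j, P j -> a i * w j <= a j * w j) ->
      alpha * a i ^+ 2 <= (\sum_j a j * w j) * (a i * w i).
    move=> alP aP.
    have : a i * \sum_(j | P j) w j <= \sum_j a j * w j.
      by rewrite mulr_sumr (le_trans _ (part P)) // ler_sum.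
    move/(ler_wpM2r (aw_ge0 i)); apply: le_trans.
    have := ler_wpM2r (sqr_ge0 (a i)) alP; lra.
  have [id|di] := ltnP i d.
    apply: (main (fun j : 'I_n => (j <= i)%N)); first exact: alpha_lo.
    by move=> j ji; rewrite ler_wpM2r ?a_mono // w_ge0 // (leq_ltn_trans ji).
  apply: (main (fun j : 'I_n => (i <= j)%N)); first exact: alpha_hi.
  by move=> j ij; rewrite ler_wnM2r ?a_mono // w_le0 // (leq_trans di).
by rewrite mulr_sumr expr2 [leRHS]mulr_sumr; apply: ler_sum => i _; apply: term.
Qed.

(** Replacing [v] by [v - c] does not change the coefficients. Orthogonality then gives the squared
    norm of [y] in terms of that of [v - c] minus a nonnegative term, and dropping this term goes in
    the right direction. *)
Lemma perm_graph_sup_bound (R : realFieldType) (F : finFieldType) (n : nat)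
    (w : 'I_n -> int) (alpha : R) (y : {perm 'I_n} * (F * F) -> R) :
  let K := \sum_i w i ^+ 2 in
  let wR i := (w i)%:~R : R in
  (1 < n)%N -> \sum_i w i = 0 ->
  2 * K + 1 <= #|F|%:Z -> 2 * (#|F| * n.-1)%:Z < #|F|.-1%:Z * K ->
  0 <= alpha ->
  (forall v : 'I_n -> R, exists (p : {perm 'I_n}) (c : R),
    alpha * \sum_i (v i - c) ^+ 2 <= perm_coef wR v p ^+ 2) ->
  eigenfun (perm_graph F _ w) (perm_eigenvalue R F _ w) y ->
  exists p, alpha * (n%:R - 1) * \sum_p y p ^+ 2 <=
    #|{: {perm 'I_n} * (F * F)}|%:R * K%:~R * y p ^+ 2.
Proof.
move=> K wR n1 w0 Kle Kge alpha0 large eig.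
have cardn : (1 < #|'I_n|)%N by rewrite card_ord.
have Kge' : 2 * (#|F| * #|'I_n|.-1)%:Z < #|F|.-1%:Z * K by rewrite card_ord.
have [v vE] := eigenfun_perm_graphP R F _ w cardn w0 Kle Kge' y eig.
have [p [c pc]] := large v; exists (p, 0); rewrite vE -/wR.
have sq : \sum_p y p ^+ 2 =
    #|F|%:R ^+ 2 * \sum_(g : {perm 'I_n}) perm_coef wR (fun i => v i - c) g ^+ 2.
  rewrite sum_pair mulr_sumr; apply: eq_bigr => g _.
  rewrite (eq_bigr _ (fun h _ => congr1 (fun x => x ^+ 2) (vE g h))).
  rewrite sumr_const card_prod perm_coef_shift ?sum_intr_weight //.
  by rewrite -[_ *+ _]mulr_natl natrM -expr2.
have n1R : 0 < n%:R - 1 :> R by rewrite subr_gt0 ltr1n.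
have n0R : 0 < n%:R :> R by rewrite ltr0n ltnW.
have KR : 0 <= K%:~R :> R by rewrite ler0z; apply: sumr_ge0 => i _; apply: sqr_ge0.
rewrite sq !card_prod !natrM.
rewrite (eq_bigr _ (fun g _ => expr2 (perm_coef wR (fun i => v i - c) g))).
rewrite sum_perm_coefM ?sum_intr_weight // sum_intr_sqr_weight card_ord -/K.
set b := fun i => v i - c.
have -> : \sum_i b i * b i = \sum_i (v i - c) ^+ 2.
  by apply: eq_bigr => i _; rewrite expr2.
set A := \sum_i _ ^+ 2 in pc *; set B := \sum_i b i.
set N := #|{perm 'I_n}|%:R : R; set q := #|F|%:R : R.
have N0 : 0 <= N by rewrite ler0n.
have -> : alpha * (n%:R - 1) * (q ^+ 2 * (N * K%:~R / (n%:R - 1) * (A - B * B / n%:R)))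
  = N * (q * q) * K%:~R * (alpha * (A - B * B / n%:R)).
  by field; rewrite !gt_eqF.
rewrite ler_wpM2l ?mulr_ge0 ?ler0n // (le_trans _ pc) // ler_wpM2l //.
by rewrite gerBl divr_ge0 ?ler0n // -expr2 sqr_ge0.
Qed.

(** * A dyadic weight decaying like an inverse square root *)

Section DyadicWeights.
Variable m : nat.
Hypothesis m_gt0 : (0 < m)%N.

Local Notation X := (4 ^ m)%N.
Local Notation d := (4 ^ m).-1.

(* An integer version of i |-> 2 ^ m / sqrt (i + 1). *)
Definition dyadic (i : nat) : nat := (2 ^ (m - trunc_log 4 i.+1))%N.

Lemma dyadic_anti i j : (i <= j)%N -> (dyadic j <= dyadic i)%N.
Proof.
by move=> ij; rewrite leq_exp2l // leq_sub2l // leq_trunc_log.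
Qed.

Lemma sqr_dyadic i : (dyadic i ^ 2 = 4 ^ (m - trunc_log 4 i.+1))%N.
Proof. by rewrite /dyadic -expnM mulnC expnM. Qed.

Lemma trunc_log_dyadic i : (i < d)%N -> (trunc_log 4 i.+1 < m)%N.
Proof.
move=> id; rewrite -(ltn_exp2l _ _ (isT : 1 < 4)%N).
by apply: leq_ltn_trans (trunc_logP (isT : 1 < 4)%N (ltn0Sn i)) _; lia.
Qed.

Lemma dyadic_sqr_ge i : (i < d)%N -> (X <= dyadic i ^ 2 * i.+1)%N.
Proof.
move=> id; rewrite sqr_dyadic.
rewrite -{1}(subnK (ltnW (trunc_log_dyadic _ id))) expnD leq_mul2l.
by rewrite trunc_logP ?orbT.
Qed.

(** As [d = 4 ^ m - 1], the numbers [i + 1] fill exactly the [m] blocks from [4 ^ k] to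
    [4 ^ k.+1 - 1]. Each has [3 * 4 ^ k] terms equal to [4 ^ (m - k)], so contributes [3 * X]. *)
Lemma sum_sqr_dyadic : (\sum_(i < d) dyadic i ^ 2 = 3 * m * X)%N.
Proof.
have blocks k : (k <= m)%N ->
    (\sum_(1 <= i < 4 ^ k) 4 ^ (m - trunc_log 4 i) = 3 * k * X)%N.
  elim: k => [|k IH] km; first by rewrite big_geq.
  have k1 : (4 ^ k <= 4 ^ k.+1)%N by rewrite leq_exp2l.
  rewrite (@big_cat_nat _ _ _ (4 ^ k)) ?expn_gt0 //= IH ?(ltnW km) //.
  rewrite (eq_big_nat _ _ (F2 := fun=> 4 ^ (m - k))%N) => [|i ik]; last first.
    by rewrite (trunc_log_eq _ ik).
  rewrite sum_nat_const_nat expnS.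
  have -> : (4 * 4 ^ k - 4 ^ k = 3 * 4 ^ k)%N by lia.
  have <- : (4 ^ k * 4 ^ (m - k) = X)%N by rewrite -expnD subnKC ?(ltnW km).
  nia.
rewrite -(blocks m) // big_add1 big_mkord; apply: eq_bigr => i _.
exact: sqr_dyadic.
Qed.

(** Antisymmetry under reversal gives sum zero, and the largest absolute values sit at both ends,
    opposite the extreme values of a sorted vector. *)
Definition dyadic_weight (i : 'I_(d + d)) : int :=
  if (i < d)%N then (dyadic i)%:Z else - (dyadic (rev_ord i))%:Z.

Lemma rev_ord_lt (i : 'I_(d + d)) : (rev_ord i < d)%N = ~~ (i < d)%N.
Proof. by have := ltn_ord i; rewrite /=; lia. Qed.

Lemma dyadic_weight_rev i : dyadic_weight (rev_ord i) = - dyadic_weight i.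
Proof.
by rewrite /dyadic_weight rev_ord_lt rev_ordK; case: (i < d)%N; rewrite /= ?opprK.
Qed.

Lemma sum_dyadic_weight : \sum_i dyadic_weight i = 0.
Proof.
have : \sum_i dyadic_weight i = - \sum_i dyadic_weight i.
  rewrite [LHS](reindex_inj rev_ord_inj) -sumrN.
  by apply: eq_bigr => i _; rewrite dyadic_weight_rev.
lia.
Qed.

Lemma sum_sqr_dyadic_weight : \sum_i dyadic_weight i ^+ 2 = (6 * m * X)%:Z.
Proof.
have lo : \sum_(i < d) dyadic_weight (lshift d i) ^+ 2 = (3 * m * X)%:Z.
  rewrite -sum_sqr_dyadic (big_morph Posz PoszD (erefl _)).
  apply: eq_bigr => i _; rewrite /dyadic_weight /= ltn_ord.
  by rewrite -[(dyadic i ^ 2)%N]/(dyadic i * dyadic i)%N PoszM expr2.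
rewrite big_split_ord /= [X in _ + X](reindex_inj rev_ord_inj) /=.
rewrite [X in _ + X](eq_bigr (fun i => dyadic_weight (lshift d i) ^+ 2)) => [|i _].
  by rewrite lo; lia.
rewrite -[lshift d i]rev_ordK dyadic_weight_rev sqrrN; congr (dyadic_weight _ ^+ 2).
by apply: val_inj => /=; have := ltn_ord i; lia.
Qed.

(** The positive weights decrease, so the partial sum is at least [i.+1] times its last term, and
    [dyadic_sqr_ge] applies. *)
Lemma dyadic_weight_tail_lo (i : 'I_(d + d)) : (i < d)%N ->
  X%:Z <= dyadic_weight i * \sum_(j : 'I_(d + d) | (j <= i)%N) dyadic_weight j.
Proof.
move=> id; have wi : dyadic_weight i = (dyadic i)%:Z by rewrite /dyadic_weight id.
have : \sum_(j : 'I_(d + d) | (j <= i)%N) (dyadic i)%:Z <=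
       \sum_(j : 'I_(d + d) | (j <= i)%N) dyadic_weight j.
  apply: ler_sum => j ji.
  by rewrite /dyadic_weight (leq_ltn_trans ji id) lez_nat dyadic_anti.
have -> : \sum_(j : 'I_(d + d) | (j <= i)%N) (dyadic i)%:Z = (dyadic i * i.+1)%:Z.
  rewrite -(big_ord_widen (d + d) (fun=> (dyadic i)%:Z) (ltn_ord i)).
  by rewrite sumr_const card_ord -mulr_natr PoszM natz.
rewrite wi; have := dyadic_sqr_ge _ id; move: (\sum_(_ | _) _) => s.
rewrite -mulnn -mulnA; nia.
Qed.

Lemma dyadic_weight_tail_hi (i : 'I_(d + d)) : (d <= i)%N ->
  X%:Z <= dyadic_weight i * \sum_(j : 'I_(d + d) | (i <= j)%N) dyadic_weight j.
Proof.
move=> di; have ri : (rev_ord i < d)%N by rewrite rev_ord_lt -leqNgt.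
apply: le_trans (dyadic_weight_tail_lo _ ri) _.
rewrite dyadic_weight_rev [X in _ <= _ * X](reindex_inj rev_ord_inj) /=.
rewrite (eq_bigr _ (fun j _ => dyadic_weight_rev j)) sumrN mulNr mulrN.
rewrite (eq_bigl (fun j : 'I_(d + d) => (i <= d + d - j.+1)%N)) // => j.
by have := ltn_ord i; have := ltn_ord j; rewrite /=; lia.
Qed.

Lemma dyadic_perm_coef_large (R : realFieldType) (v : 'I_(d + d) -> R) :
  exists (p : {perm 'I_(d + d)}) (c : R),
    X%:R * \sum_i (v i - c) ^+ 2 <=
    perm_coef (fun i => (dyadic_weight i)%:~R) v p ^+ 2.
Proof.
have d0 : (0 < d)%N by rewrite -ltnS prednK ?expn_gt0 // -(expn0 4) ltn_exp2l.
have dd : (d < d + d)%N by rewrite -{1}[d]addn0 ltn_add2l.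
have castS (P : pred 'I_(d + d)) :
  \sum_(j | P j) (dyadic_weight j)%:~R = (\sum_(j | P j) dyadic_weight j)%:~R :> R.
  by rewrite rmorph_sum.
apply: (perm_coef_large _ _ _ (Ordinal dd)) => /= [|i id|i di|i id|i di].
- by rewrite castS sum_dyadic_weight.
- by rewrite ler0z /dyadic_weight id.
- by rewrite lerz0 /dyadic_weight ltnNge di /= oppr_le0.
- by rewrite castS -intrM -[leLHS]/(X%:Z%:~R) ler_int dyadic_weight_tail_lo.
- by rewrite castS -intrM -[leLHS]/(X%:Z%:~R) ler_int dyadic_weight_tail_hi.
Qed.

End DyadicWeights.

(** * Passage between real and complex eigenfunctions, and norms *)

Section ComplexEigenfunctions.
Variables (R : rcfType) (gT : finGroupType) (S : {set gT}) (lambda : R).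
Hypothesis cS : cayley_set S.

Lemma eigenspace_ReIm (x : gT -> R[i]) :
  (fun_row x <= eigenspace (cayley_adjmx R[i] S) lambda%:C%C)%MS ->
  eigenfun S lambda (fun g => complex.Re (x g)) /\
  eigenfun S lambda (fun g => complex.Im (x g)).
Proof.
move=> /fun_row_eigenspaceP-/(_ cS) xE.
have ReD : {morph @complex.Re R : u v / u + v} by move=> [? ?] [? ?].
have ImD : {morph @complex.Im R : u v / u + v} by move=> [? ?] [? ?].
split=> g.
  have /(congr1 (@complex.Re R)) := xE g; rewrite (big_morph _ ReD (erefl _)) => ->.
  by case: (x g) => a b /=; rewrite mul0r subr0.
have /(congr1 (@complex.Im R)) := xE g; rewrite (big_morph _ ImD (erefl _)) => ->.
by case: (x g) => a b /=; rewrite mul0r addr0.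
Qed.

Lemma eigenvalue_eigenfun (y : gT -> R) (g : gT) :
  eigenfun S lambda y -> y g != 0 ->
  eigenvalue (cayley_adjmx R[i] S) lambda%:C%C.
Proof.
move=> yE yg; pose x g := (y g)%:C%C.
have : (fun_row x <= eigenspace (cayley_adjmx R[i] S) lambda%:C%C)%MS.
  apply/fun_row_eigenspaceP => // h.
  by rewrite /x -(rmorph_sum (real_complex R)) yE rmorphM.
move/eigenspaceP => xE; apply/eigenvalueP; exists (fun_row x) => //.
apply: contraNneq yg => /rowP /(_ (enum_rank g)); rewrite !mxE enum_rankK.
by move/(congr1 (@complex.Re R)) => /= ->.
Qed.

End ComplexEigenfunctions.

Lemma sqr_normc (R : rcfType) (z : R[i]) :
  ComplexField.Normc.normc z ^+ 2 = complex.Re z ^+ 2 + complex.Im z ^+ 2.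
Proof. by case: z => a b /=; rewrite sqr_sqrtr // addr_ge0 ?sqr_ge0. Qed.

Lemma normc_ge0 (R : rcfType) (z : R[i]) : 0 <= ComplexField.Normc.normc z.
Proof. by case: z => a b; rewrite sqrtr_ge0. Qed.

Lemma Linfnorm_sqr_ge (R : realType) (gT : finType) (x : gT -> R[i]) g :
  complex.Re (x g) ^+ 2 + complex.Im (x g) ^+ 2 <= Linfnorm x ^+ 2.
Proof.
rewrite -sqr_normc lerXn2r ?nnegrE ?normc_ge0 //.
  exact: le_trans (normc_ge0 _ _) (le_bigmax _ _ g).
exact: (le_bigmax _ _ g).
Qed.

Lemma Lpnorm2E (R : realType) (gT : finType) (x : gT -> R[i]) :
  Lpnorm 2 x = Num.sqrt (#|gT|%:R^-1 *
    (\sum_g complex.Re (x g) ^+ 2 + \sum_g complex.Im (x g) ^+ 2)).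
Proof.
rewrite /Lpnorm powR12_sqrt; last first.
  by rewrite mulr_ge0 ?invr_ge0 ?ler0n // sumr_ge0 // => g _; apply: powR_ge0.
congr (Num.sqrt (_ * _)); rewrite -big_split; apply: eq_bigr => g _ /=.
by rewrite (powR_mulrn 2) ?normc_ge0 // sqr_normc.
Qed.

(** * Logarithmic and factorial estimates *)

Lemma ln2_bounds (R : realType) : 1 / 2 <= (ln 2 : R) <= 1.
Proof.
have : ln (1 + - 2^-1) <= - 2^-1 :> R by apply: le_ln1Dx; lra.
have -> : 1 + - 2^-1 = 2^-1 :> R by lra.
have : ln (1 + 1) <= 1 :> R by apply: le_ln1Dx; lra.
by rewrite lnV ?posrE // => *; lra.
Qed.

(** Here [E] stands for the mean square and [L] for the maximum. From [ln n <= 10 m X] one gets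
    [ln n * E <= 120 m^2 L^2 <= (11 m L)^2], while [ln (ln n) >= ln (X / 2) = (2 m - 1) ln 2 >= m /
    2]. The quotient is at most [22 L], so [30] is ample. *)
Lemma log_ratio_le (R : realType) (m n : nat) (E L : R) : (0 < m)%N ->
  (2 ^ (4 ^ m) <= n <= 2 ^ (10 * m * 4 ^ m))%N ->
  (4 ^ m)%:R * E <= 12 * m%:R * L ^+ 2 -> 0 <= L ->
  30^-1 * (Num.sqrt (ln n%:R) / ln (ln n%:R)) * Num.sqrt E <= L.
Proof.
move=> m0 /andP[nlo nhi] EL L0; have /andP[l2lo l2hi] := ln2_bounds R.
set X := (4 ^ m)%N in nlo nhi EL *.
have X4 : (4 <= X)%N by rewrite -[4%N]/(4 ^ 1)%N leq_exp2l.
have X0 : 0 < X%:R :> R by rewrite ltr0n; lia.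
have n0 : 0 < n%:R :> R by rewrite ltr0n (leq_trans _ nlo) // expn_gt0.
have lnp k : ln (2 ^ k)%N%:R = k%:R * ln 2 :> R.
  by rewrite natrX lnXn // mulr_natl.
have p0 k : 0 < (2 ^ k)%N%:R :> R by rewrite ltr0n expn_gt0.
have lo : X%:R * ln 2 <= ln n%:R :> R.
  by rewrite -lnp ler_ln ?posrE // ler_nat.
have hi : ln n%:R <= (10 * m * X)%:R :> R.
  apply: (@le_trans _ _ ((10 * m * X)%:R * ln 2)).
    by rewrite -lnp ler_ln ?posrE // ler_nat.
  by rewrite ler_piMr ?ler0n.
have ln0 : 0 < ln n%:R :> R by nra.
have mR : 1 <= m%:R :> R by rewrite ler1n.
have lnln : m%:R / 2 <= ln (ln n%:R) :> R.
  have XE : X = (2 ^ (2 * m))%N by rewrite expnM.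
  have : ln (X%:R * 2^-1) <= ln (ln n%:R) :> R.
    rewrite ler_ln ?posrE ?mulr_gt0 ?invr_gt0 //; nra.
  rewrite lnM ?posrE ?invr_gt0 // lnV ?posrE // XE lnp natrM => le1.
  apply: le_trans le1; nra.
have lnln0 : 0 < ln (ln n%:R) :> R by lra.
have key : Num.sqrt (ln n%:R) * Num.sqrt E <= 11 * m%:R * L.
  have mL : 0 <= 11 * m%:R * L by rewrite !mulr_ge0 ?ler0n.
  rewrite -sqrtrM ?(ltW ln0) // -[leRHS](ger0_norm mL) -sqrtr_sqr ler_wsqrtr //.
  have [E0|E0] := leP E 0.
    by apply: (@le_trans _ _ 0); rewrite ?sqr_ge0 // mulr_ge0_le0 // ltW.
  apply: (@le_trans _ _ (10 * m%:R * (X%:R * E))).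
    by rewrite mulrA ler_pM2r // -!natrM.
  have := ler_wpM2l (_ : 0 <= 10 * m%:R) EL => /(_ (mulr_ge0 _ _)) EL'.
  apply: le_trans (EL' _ _) _; rewrite ?ler0n //.
  by have := sqr_ge0 (m%:R * L); lra.
set a := Num.sqrt (ln n%:R) in key *; set e := Num.sqrt E in key *.
set b := ln (ln n%:R) in lnln lnln0 *.
have -> : 30^-1 * (a / b) * e = a * e / (30 * b) by field; rewrite gt_eqF.
rewrite ler_pdivrMr ?mulr_gt0 //; apply: le_trans key _.
by have := ler_wpM2l L0 lnln; nra.
Qed.

Lemma fact_le_expn n : (n`! <= n ^ n)%N.
Proof.
elim: n => // n IH; rewrite factS expnS leq_mul2l /=.
by apply: leq_trans IH _; case: n => // n; rewrite leq_exp2r.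
Qed.

Lemma expn_le_factS n : (2 ^ n <= n.+1`!)%N.
Proof. by elim: n => // n IH; rewrite factS expnS leq_mul. Qed.

(** The factorial dominates: it is at least [2 ^ (2 d - 1)], and at most [(2 d) ^ (2 d)] with
    [2 d <= 2 ^ (2 m + 1)]. The plane only adds [8 m + 8] to the exponent. *)
Lemma dyadic_card_bounds (m : nat) : (0 < m)%N ->
  (2 ^ (4 ^ m) <= ((4 ^ m).-1 + (4 ^ m).-1)`! *
    (2 ^ (4 * m + 4) * 2 ^ (4 * m + 4)) <= 2 ^ (10 * m * 4 ^ m))%N.
Proof.
set d := (4 ^ m).-1; set q := (2 ^ (4 * m + 4))%N => m0.
have X4 : (4 <= 4 ^ m)%N by rewrite -[4%N]/(4 ^ 1)%N leq_exp2l.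
apply/andP; split.
  have dE : (d + d)%N = (d + d).-1.+1 by rewrite /d; lia.
  apply: (@leq_trans (d + d)`!); last by rewrite leq_pmulr // muln_gt0 !expn_gt0.
  rewrite dE; apply: leq_trans (expn_le_factS _); rewrite leq_exp2l // /d; lia.
have fact_hi : ((d + d)`! <= 2 ^ ((2 * m + 1) * (d + d)))%N.
  apply: leq_trans (fact_le_expn _) _; rewrite expnM.
  have dX : (d + d <= 2 ^ (2 * m + 1))%N.
    by rewrite expnD expnM -[(2 ^ 2)%N]/4%N /d; lia.
  by rewrite leq_exp2r // /d; lia.
apply: leq_trans (leq_mul fact_hi (leqnn _)) _.
rewrite /q -!expnD leq_exp2l // /d; move: X4; move: (4 ^ m)%N => X; nia.
Qed.

(** * The graphs given by the dyadic weights *)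

Section DyadicGraph.
Variables (R : realType) (m : nat) (F : finFieldType).
Hypotheses (m_gt0 : (0 < m)%N) (cardF : #|F| = (2 ^ (4 * m + 4))%N).

Local Notation d := (4 ^ m).-1.
Local Notation X := (4 ^ m)%N.
Local Notation w := (dyadic_weight m).
Local Notation gT := ({perm 'I_(d + d)} * (F * F))%type.
Local Notation S := (perm_graph F _ w).
Local Notation lambda := (perm_eigenvalue R F _ w).

Lemma expn4_ge4 : (4 <= X)%N.
Proof. by rewrite -[4%N]/(4 ^ 1)%N leq_exp2l. Qed.

Lemma dyadic_dim_gt1 : (1 < d + d)%N.
Proof. by have := expn4_ge4; lia. Qed.

Lemma cardF_X : #|F| = (16 * (X * X))%N.
Proof.
rewrite cardF expnD mulnC; congr (_ * _)%N.
by rewrite -expnD -[4%N in RHS]/(2 ^ 2)%N -expnM; congr expn; lia.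
Qed.

(** The choice [#|F| = 16 X^2] leaves room for [2 K + 1 = 12 m X + 1], as [m <= X]. *)
Lemma dyadic_K_le : 2 * (\sum_i w i ^+ 2) + 1 <= #|F|%:Z.
Proof.
rewrite sum_sqr_dyadic_weight // cardF_X.
have : (m * X <= X * X)%N by rewrite leq_mul2r ltnW ?orbT // ltn_expl.
have : (4 * 4 <= X * X)%N by rewrite leq_mul ?expn4_ge4.
move: X => x; lia.
Qed.

(** Here [K = 6 m X >= 6 X], against [2 (2 d - 1) < 4 X]; the slack absorbs the loss from [#|F|] to
    its predecessor. *)
Lemma dyadic_K_ge :
  2 * (#|F| * (d + d).-1)%:Z < #|F|.-1%:Z * \sum_i w i ^+ 2.
Proof.
rewrite sum_sqr_dyadic_weight // -PoszM -[2]/(Posz 2) -PoszM ltz_nat.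
have : (X <= #|F|)%N by rewrite cardF_X mulnA leq_pmull ?muln_gt0 ?expn_gt0.
have : (X <= m * X)%N by rewrite leq_pmull.
rewrite -mulnA; move: (m * X)%N #|F| expn4_ge4 => k [|f]; first by lia.
case: X => [|[|x]] //= x4 kx xf; apply: (@leq_trans (f * (6 * x.+2))%N).
  have : (3 * x <= f * x)%N by rewrite leq_mul2r; lia.
  by rewrite addnS /=; lia.
by rewrite !leq_mul2l kx !orbT.
Qed.

Lemma dyadic_K_ge_card : 2 * (#|F| * #|'I_(d + d)|.-1)%:Z <
  #|F|.-1%:Z * \sum_i w i ^+ 2.
Proof. by rewrite card_ord dyadic_K_ge. Qed.

Lemma dyadic_card_gt1 : (1 < #|'I_(d + d)|)%N.
Proof. by rewrite card_ord dyadic_dim_gt1. Qed.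

Lemma cayley_dyadic_graph : cayley_set S.
Proof.
exact: (cayley_perm_graph _ _ _ dyadic_card_gt1 (sum_dyadic_weight m m_gt0)
  dyadic_K_le dyadic_K_ge_card).
Qed.

Lemma card_dyadic_graph :
  (2 ^ X <= #|{: gT}| <= 2 ^ (10 * m * X))%N.
Proof. by rewrite !card_prod card_Sn cardF dyadic_card_bounds. Qed.

(** In [perm_graph_sup_bound] take [alpha = X] and [K = 6 m X]; since [2 d - 1 >= X], one factor [X]
    cancels. *)
Lemma dyadic_graph_sup (y : gT -> R) : eigenfun S lambda y ->
  exists p, X%:R * (#|{: gT}|%:R^-1 * \sum_p y p ^+ 2) <= 6 * m%:R * y p ^+ 2.
Proof.
move=> eig.
have [p pP] := perm_graph_sup_bound R F _ w X%:R y dyadic_dim_gt1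
  (sum_dyadic_weight m m_gt0) dyadic_K_le dyadic_K_ge (ler0n _ _)
  (dyadic_perm_coef_large m m_gt0 R) eig.
exists p; move: pP; rewrite sum_sqr_dyadic_weight // -pmulrn.
have n0 : 0 < #|{: gT}|%:R :> R by rewrite ltr0n; apply/card_gt0P; exists (1%g, 0).
have X0 : 0 < X%:R :> R by rewrite ltr0n expn_gt0.
have XD : X%:R <= (d + d)%:R - 1 :> R.
  by rewrite lerBrDr natr1 ler_nat; have := expn4_ge4; lia.
have Y0 : 0 <= \sum_p y p ^+ 2 by apply: sumr_ge0 => i _; apply: sqr_ge0.
rewrite !natrM; move: (\sum_p _) Y0 => Y Y0.
move: #|{: gT}|%:R n0 X%:R X0 ((d + d)%:R - 1) XD => n n0 x x0 D xD pP.
have {}pP : x * Y <= n * (6 * m%:R) * y p ^+ 2.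
  rewrite -(ler_pM2l x0); apply: (@le_trans _ _ (x * D * Y)).
    by rewrite mulrA ler_wpM2r // ler_pM2l.
  by apply: le_trans pP _; rewrite le_eqVlt; apply/orP; left; apply/eqP; ring.
by rewrite mulrCA mulrC ler_pdivrMr //; apply: le_trans pP _; lra.
Qed.

Lemma dyadic_graph_eigenvalue : eigenvalue (cayley_adjmx R[i] S) lambda%:C%C.
Proof.
apply: (eigenvalue_eigenfun _ _ _ _ cayley_dyadic_graph _ (1%g, 0)
  (eigenfun_perm_graph R F _ w dyadic_card_gt1 (sum_dyadic_weight m m_gt0) dyadic_K_le
    dyadic_K_ge_card)).
rewrite /perm_coef (eq_bigr (fun i => (w i)%:~R ^+ 2)) => [|i _]; last first.
  by rewrite perm1 expr2.
rewrite sum_intr_sqr_weight sum_sqr_dyadic_weight // -pmulrn pnatr_eq0.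
by rewrite !muln_eq0 expn_eq0; lia.
Qed.

(** The real and imaginary parts may peak at different points, but each peak is at most the maximum
    of the modulus. Adding the two bounds turns [6 m] into the [12 m] of [log_ratio_le]. *)
Lemma dyadic_graph_norms (x : gT -> R[i]) :
  (fun_row x <= eigenspace (cayley_adjmx R[i] S) lambda%:C%C)%MS ->
  30^-1 * (Num.sqrt (ln #|{: gT}|%:R) / ln (ln #|{: gT}|%:R)) * Lpnorm 2 x
    <= Linfnorm x.
Proof.
move=> /(eigenspace_ReIm _ _ _ _ cayley_dyadic_graph) [ReE ImE].
have [p pP] := dyadic_graph_sup _ ReE; have [p' pP'] := dyadic_graph_sup _ ImE.
rewrite Lpnorm2E; apply: (log_ratio_le _ m) => //; first exact: card_dyadic_graph.
  have := Linfnorm_sqr_ge _ _ x p; have := Linfnorm_sqr_ge _ _ x p'.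
  rewrite mulrDr mulrDr => h h'.
  have b : complex.Re (x p) ^+ 2 <= Linfnorm x ^+ 2.
    by have := sqr_ge0 (complex.Im (x p)); lra.
  have b' : complex.Im (x p') ^+ 2 <= Linfnorm x ^+ 2.
    by have := sqr_ge0 (complex.Re (x p')); lra.
  have m6 : 0 <= 6 * m%:R :> R by rewrite mulr_ge0 ?ler0n.
  have := ler_wpM2l m6 b; have := ler_wpM2l m6 b'; lra.
exact: le_trans (normc_ge0 _ (x (1%g, 0))) (le_bigmax _ _ _).
Qed.

End DyadicGraph.

Theorem theorem1p2 (R : realType) :
  exists2 c : R, 0 < c &
    forall N : nat, exists (gT : finGroupType) (S : {set gT}),
      [/\ cayley_set S, (N < #|gT|)%N &
        exists2 lambda : R[i], eigenvalue (cayley_adjmx R[i] S) lambda &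
          forall x : gT -> R[i],
            (fun_row x <= eigenspace (cayley_adjmx R[i] S) lambda)%MS ->
            c * (Num.sqrt (ln #|gT|%:R) / ln (ln #|gT|%:R)) * Lpnorm 2 x
              <= Linfnorm x].
Proof.
exists 30^-1 => [|N]; first by rewrite invr_gt0.
have m0 : (0 < N.+1)%N by [].
have k0 : (0 < 4 * N.+1 + 4)%N by rewrite addn_gt0 orbT.
have [F _ cardF] := @pPrimePowerField 2 _ isT k0.
exists _, (perm_graph F _ (dyadic_weight N.+1)); split.
- exact: cayley_dyadic_graph cardF.
(* With [m = N.+1], the order is at least [2 ^ (4 ^ m) >= 4 ^ m >= m > N]. *)
- have /andP[lo _] := card_dyadic_graph _ _ m0 cardF; apply: leq_trans lo.
  apply: leq_trans (ltnW (ltn_expl _ (isT : 1 < 2)%N)).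
  by apply: leq_trans (ltnW (ltn_expl _ (isT : 1 < 4)%N)).
- exists (perm_eigenvalue R F _ (dyadic_weight N.+1))%:C%C.
    exact: dyadic_graph_eigenvalue cardF.
  by move=> x; apply: dyadic_graph_norms cardF x.
Qed.
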